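(* Let $A\in\mathbb{C}^{m\times n}$, $W\in\mathbb{C}^{n\times m}$ and let $l$ be a non-negative integer such that $l\ge k=\max\{\mathrm{ind}(AW),\mathrm{ind}(WA)\}$. Then $A^{\mathrm{cEP},W}$ can be written as follows: $$A^{\mathrm{cEP},W}=(AW)^l[W(AW)^{l+1}]^{\dagger};$$ $$A^{\mathrm{cEP},W}=A(WA)^l[(WA)^{l+2}]^{\dagger}.$$
   Context: For a square complex matrix $B$, $\mathrm{ind}(B)$ is the smallest non-negative integer $j$ with $\mathrm{rank}(B^j)=\mathrm{rank}(B^{j+1})$ (with $B^0=I$). $B^{\dagger}$ and $\mathcal{R}(B)$ denote the Moore-Penrose inverse and range (column space) of $B$. For $A\in\mathbb{C}^{m\times n}$, $W\in\mathbb{C}^{n\times m}$ and $k=\max\{\mathrm{ind}(AW),\mathrm{ind}(WA)\}$, the $W$-weighted core-EP inverse $A^{\mathrm{cEP},W}$ is the unique $Y\in\mathbb{C}^{m\times n}$ with $WAWY=(WA)^k[(WA)^k]^{\dagger}$ and $\mathcal{R}(Y)\subseteq\mathcal{R}((AW)^k)$. *)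

(* Defs.v *)
From mathcomp Require Export all_boot all_order all_algebra.
From mathcomp Require Export sesquilinear spectral complex reals.

Set Implicit Arguments.
Unset Strict Implicit.
Unset Printing Implicit Defensive.

Import Order.TTheory GRing.Theory Num.Theory.
Local Open Scope ring_scope.
Local Open Scope sesquilinear_scope.

Lemma mxind_subproof (F : fieldType) (n : nat) (B : 'M[F]_n) :
  exists j, \rank (B ^+ j) == \rank (B ^+ j.+1).
Proof.
have [/existsP[j ej]|/existsPn ne] :=
  boolP [exists j : 'I_n.+1, \rank (B ^+ j) == \rank (B ^+ j.+1)].
  by exists j.
suff H j : (j <= n.+1)%N -> (\rank (B ^+ j) + j <= n)%N.
  by have := H _ (leqnn _); rewrite addnS ltnNge leq_addl.
elim: j => [_|j IHj lt_jn]; first by rewrite addn0 rank_leq_row.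
apply: leq_trans (IHj (ltnW lt_jn)); rewrite addnS -addSn leq_add2r.
rewrite ltn_neqAle eq_sym (ne (Ordinal lt_jn)) /=.
by rewrite exprS; apply: mxrankM_maxr.
Qed.

Definition mxind (F : fieldType) (n : nat) (B : 'M[F]_n) : nat :=
  ex_minn (mxind_subproof B).

(* The four Penrose equations; [^t*] is the conjugate transpose. *)
Definition is_mpinv (C : numClosedFieldType) (m n : nat) (B : 'M[C]_(m, n))
    (X : 'M[C]_(n, m)) : bool :=
  [&& B *m X *m B == B, X *m B *m X == X,
      (B *m X) ^t* == B *m X & (X *m B) ^t* == X *m B].

Section MoorePenrose.
Variable C : numClosedFieldType.

Let ctrM m n p (A : 'M[C]_(m, n)) (B : 'M[C]_(n, p)) :
  (A *m B) ^t* = B ^t* *m A ^t*.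
Proof. by rewrite trmx_mul map_mxM. Qed.

Let mul_ctr_eq0 m n (v : 'M[C]_(m, n)) : v *m v ^t* = 0 -> v = 0.
Proof.
move=> v0; apply/matrixP=> i j; rewrite mxE.
have /matrixP/(_ i i) := v0; rewrite !mxE => s0.
have nn k : true -> 0 <= v i k * v ^t* k i.
  by move=> _; rewrite !mxE -normCK exprn_ge0.
have /eqP := psumr_eq0P nn s0 (i := j) isT.
by rewrite !mxE -normCK expf_eq0 /= normr_eq0 => /eqP.
Qed.

Let gram_unit m n (N : 'M[C]_(m, n)) : row_free N -> N *m N ^t* \in unitmx.
Proof.
move=> Nf; rewrite -row_free_unit -kermx_eq0; apply/eqP.
set K := kermx _; have K0 : K *m (N *m N ^t*) = 0 by apply: mulmx_ker.
have: (K *m N) *m (K *m N) ^t* = 0.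
  by rewrite ctrM mulmxA -(mulmxA K) K0 mul0mx.
by move/mul_ctr_eq0/eqP; rewrite mulmx_free_eq0 // => /eqP.
Qed.

Lemma mpinv_subproof m n (B : 'M[C]_(m, n)) : exists X, is_mpinv B X.
Proof.
have [r [L [R [defB Rf Lf]]]] : exists r (L : 'M_(m, r)) (R : 'M_(r, n)),
    [/\ L *m R = B, row_free R & row_full L].
  exists (\rank B), (col_base B), (row_base B).
  by rewrite mulmx_base row_base_free col_base_full.
have uR : R *m R ^t* \in unitmx by apply: gram_unit.
have uL : L ^t* *m L \in unitmx.
  rewrite -[X in _ *m X]trmxCK; apply: gram_unit.
  by rewrite /row_free mxrank_map mxrank_tr.
pose G := R *m R ^t*; pose H := L ^t* *m L.
have Gs : G ^t* = G by rewrite ctrM trmxCK.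
have Hs : H ^t* = H by rewrite ctrM trmxCK.
have GVs : (invmx G) ^t* = invmx G by rewrite trmx_inv map_invmx Gs.
have HVs : (invmx H) ^t* = invmx H by rewrite trmx_inv map_invmx Hs.
pose X := R ^t* *m invmx G *m (invmx H *m L ^t*).
have BX : B *m X = L *m (invmx H *m L ^t*).
  by rewrite -defB /X -mulmxA (mulmxA R) (mulmxA R) mulmxV // mul1mx.
have XB : X *m B = R ^t* *m invmx G *m R.
  rewrite -defB /X -mulmxA (mulmxA _ L) -(mulmxA (invmx H)) mulVmx //.
  by rewrite mul1mx.
exists X; apply/and4P; split; apply/eqP.
- rewrite BX -[in LHS]defB -!mulmxA (mulmxA _ L) (mulmxA (invmx H)).
  by rewrite mulVmx // mul1mx.
- rewrite XB /X -!mulmxA (mulmxA R) (mulmxA (invmx G) (R *m _)).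
  by rewrite mulVmx // mul1mx.
- by rewrite BX !ctrM trmxCK HVs mulmxA.
- by rewrite XB !ctrM trmxCK GVs mulmxA.
Qed.

Definition mpinv m n (B : 'M[C]_(m, n)) : 'M[C]_(n, m) :=
  xchoose (mpinv_subproof B).

Lemma mpinvP m n (B : 'M[C]_(m, n)) : is_mpinv B (mpinv B).
Proof. exact: xchooseP. Qed.

Lemma mpinv_unique m n (B : 'M[C]_(m, n)) X Y :
  is_mpinv B X -> is_mpinv B Y -> X = Y.
Proof.
move=> /and4P[/eqP X1 /eqP X2 /eqP X3 /eqP X4].
move=> /and4P[/eqP Y1 /eqP Y2 /eqP Y3 /eqP Y4].
have e1 : B *m X = B *m Y.
  rewrite -[in LHS]Y1 -(mulmxA (B *m Y)) -[in LHS]X3 -[in LHS]Y3 -ctrM.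
  by rewrite mulmxA X1 Y3.
have e2 : X *m B = Y *m B.
  rewrite -[in LHS]Y1 -(mulmxA B) mulmxA -[in LHS]X4 -[in LHS]Y4 -ctrM.
  by rewrite -mulmxA (mulmxA B) X1 Y4.
by rewrite -X2 e2 -mulmxA e1 mulmxA.
Qed.

End MoorePenrose.

(* The range R(B) is the column space of B, i.e. the row space of B^T. *)
Definition is_wcepinv (C : numClosedFieldType) (m n : nat) (A : 'M[C]_(m, n))
    (W : 'M[C]_(n, m)) (Y : 'M[C]_(m, n)) : bool :=
  let k := maxn (mxind (A *m W)) (mxind (W *m A)) in
  (W *m A *m W *m Y == (W *m A) ^+ k *m mpinv ((W *m A) ^+ k))
  && (Y^T <= ((A *m W) ^+ k)^T)%MS.

Section WeightedCoreEP.
Variable C : numClosedFieldType.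

Let ind_stable n (B : 'M[C]_n) j i : (mxind B <= j)%N ->
  \rank (B ^+ (j + i)) = \rank (B ^+ j).
Proof.
rewrite /mxind; case: ex_minnP => d /eqP ed _.
have sub : (B ^+ d <= B ^+ d.+1)%MS.
  have s1: (B ^+ d.+1 <= B ^+ d)%MS by rewrite exprS submxMl.
  by rewrite -(mxrank_leqif_sup s1).2 ed.
have H p : \rank (B ^+ (d + p)) = \rank (B ^+ d).
  elim: p => [|p IHp]; first by rewrite addn0.
  rewrite -IHp addnS; apply/eqP; rewrite eqn_leq; apply/andP; split.
    by rewrite exprS mxrankM_maxr.
  by rewrite -addSn !exprD mxrankS // submxMr.
by move=> /subnKC <-; rewrite -addnA !H.
Qed.

Let ind_fact n (B : 'M[C]_n) j : (mxind B <= j)%N ->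
  exists T, B ^+ j = B ^+ j.+2 *m T.
Proof.
move=> le_ij; suff /submxP[T eT] : ((B ^+ j)^T <= (B ^+ j.+2)^T)%MS.
  by exists T^T; apply: trmx_inj; rewrite eT -[T in LHS]trmxK -trmx_mul.
have s : ((B ^+ j.+2)^T <= (B ^+ j)^T)%MS.
  by rewrite -addn2 exprD trmx_mul submxMl.
by rewrite -(mxrank_leqif_sup s).2 !mxrank_tr -addn2 ind_stable.
Qed.

Let ind_inj n p (B : 'M[C]_n) j (Z : 'M_(n, p)) : (mxind B <= j)%N ->
  B ^+ j.+2 *m Z = 0 -> B ^+ j *m Z = 0.
Proof.
move=> le_ij Z0; suff /submxP[T ->] : (B ^+ j <= B ^+ j.+2)%MS.
  by rewrite -mulmxA Z0 mulmx0.
have s : (B ^+ j.+2 <= B ^+ j)%MS by rewrite -add2n exprD submxMl.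
by rewrite -(mxrank_leqif_sup s).2 -addn2 ind_stable.
Qed.

Let expr_swap m n (A : 'M[C]_(m, n)) (W : 'M[C]_(n, m)) j :
  (A *m W) ^+ j *m A = A *m (W *m A) ^+ j.
Proof.
elim: j => [|j IHj]; first by rewrite !expr0 mul1mx mulmx1.
rewrite exprS -[_ * _]/(_ *m _) -mulmxA IHj exprS -[_ * _]/(_ *m _).
by rewrite !mulmxA.
Qed.

Lemma wcepinv_subproof m n (A : 'M[C]_(m, n)) (W : 'M[C]_(n, m)) :
  exists Y, is_wcepinv A W Y.
Proof.
rewrite /is_wcepinv /=; set k := maxn _ _.
have [|T eT] := @ind_fact _ (W *m A) k; first exact: leq_maxr.
exists ((A *m W) ^+ k *m (A *m T *m mpinv ((W *m A) ^+ k))).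
apply/andP; split; last by rewrite trmx_mul submxMl.
apply/eqP; rewrite [in X in _ = X *m _]eT !exprS -![_ * _]/(_ *m _).
by rewrite !mulmxA -(mulmxA _ _ A) expr_swap !mulmxA.
Qed.

Definition wcepinv m n (A : 'M[C]_(m, n)) (W : 'M[C]_(n, m)) : 'M[C]_(m, n) :=
  xchoose (wcepinv_subproof A W).

Lemma wcepinvP m n (A : 'M[C]_(m, n)) (W : 'M[C]_(n, m)) :
  is_wcepinv A W (wcepinv A W).
Proof. exact: xchooseP. Qed.

Lemma wcepinv_unique m n (A : 'M[C]_(m, n)) (W : 'M[C]_(n, m)) Y1 Y2 :
  is_wcepinv A W Y1 -> is_wcepinv A W Y2 -> Y1 = Y2.
Proof.
rewrite /is_wcepinv /=; set k := maxn _ _.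
move=> /andP[/eqP e1 /submxP[Z1 r1]] /andP[/eqP e2 /submxP[Z2 r2]].
have {}r1 : Y1 = (A *m W) ^+ k *m Z1^T.
  by apply: trmx_inj; rewrite r1 -[Z1 in LHS]trmxK -trmx_mul.
have {}r2 : Y2 = (A *m W) ^+ k *m Z2^T.
  by apply: trmx_inj; rewrite r2 -[Z2 in LHS]trmxK -trmx_mul.
apply/eqP; rewrite -subr_eq0 r1 r2 -mulmxBr; apply/eqP.
apply: ind_inj; first exact: leq_maxl.
rewrite !exprS -![_ * _]/(_ *m _) -!mulmxA mulmxBr -r1 -r2.
by rewrite !mulmxBr !mulmxA in e1 e2 *; rewrite -!(mulmxA A) e1 e2 subrr.
Qed.

End WeightedCoreEP.

(* Main.v *)
Require Import Defs.
From mathcomp Require Import all_boot all_order all_algebra.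
From mathcomp Require Import complex reals.

Set Implicit Arguments.
Unset Strict Implicit.
Unset Printing Implicit Defensive.

Import GRing.Theory.

(** Put [G := (A W)^l Z], where [Z] is the identity for the first formula and
    [A] for the second, since [A (W A)^l = (A W)^l A]. In both formulas the
    matrix under the dagger is [M := W A W G], so the claim is that
    [Y := G M^dagger] satisfies the two conditions that characterize the
    weighted core-EP inverse. The range condition holds because
    [R(Y) <= R((A W)^l) <= R((A W)^k)]. The equation holds because
    [W A W Y = M M^dagger] is the orthogonal projector onto [R(M)], which is
    determined by [R(M)] alone ([mpinv_proj_eq]): it remains to see that
    [R(M) = R((W A)^k)]. As [M = (W A)^(l+1) W Z], one inclusion is clear.
    For the other one, [(W A)^(l+2)] is a right multiple of [M] for both
    choices of [Z], and the ranges of the powers of [W A] are constant from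
    the exponent [ind(W A)] on ([expr_stable_range]). *)

Local Open Scope ring_scope.
Local Open Scope sesquilinear_scope.

(** [M M^dagger] is the orthogonal projector onto the range of [M]. For two
    self-adjoint idempotents [P], [Q] with the same range, [P Q = Q] and
    [Q P = P], and taking adjoints in the first equation gives [Q P = Q]. *)
Lemma mpinv_proj_eq (C : numClosedFieldType) (m n p : nat)
    (M : 'M[C]_(m, n)) (N : 'M[C]_(m, p)) S T :
  M = N *m S -> N = M *m T -> M *m mpinv M = N *m mpinv N.
Proof.
move=> eM eN.
have /and4P[/eqP M1 _ /eqP M3 _] := mpinvP M.
have /and4P[/eqP N1 _ /eqP N3 _] := mpinvP N.
set P := M *m mpinv M in M1 M3 *; set Q := N *m mpinv N in N1 N3 *.
have PQ : P *m Q = Q by rewrite /Q mulmxA {1}eN mulmxA M1 -eN.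
have QP : Q *m P = P by rewrite /P mulmxA {1}eM mulmxA N1 -eM.
by rewrite -[RHS]N3 -[in RHS]PQ trmx_mul map_mxM /= M3 N3 QP.
Qed.

Lemma expmxS (F : fieldType) (n : nat) (B : 'M[F]_n) (i : nat) :
  B ^+ i.+1 = B *m B ^+ i.
Proof. exact: exprS. Qed.

Lemma expmxD (F : fieldType) (n : nat) (B : 'M[F]_n) (i j : nat) :
  B ^+ (i + j) = B ^+ i *m B ^+ j.
Proof. exact: exprD. Qed.

(** At the index [d], equality of ranks turns the inclusion
    [R(B^(d+1)) <= R(B^d)] into an equality, so [B^d = B^(d+1) T].
    Substituting this equation into itself [i] times gives
    [B^d = B^(d+i) T^i], which is then multiplied by [B^(j-d)]. *)
Lemma expr_stable_range (F : fieldType) (n : nat) (B : 'M[F]_n) (j i : nat) :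
  (mxind B <= j)%N -> exists T, B ^+ j = B ^+ (j + i) *m T.
Proof.
rewrite /mxind; case: ex_minnP => d /eqP ed _ le_dj.
have [T eT] : exists T, B ^+ d = B ^+ d.+1 *m T.
  suff /submxP[T eT] : ((B ^+ d)^T <= (B ^+ d.+1)^T)%MS.
    by exists T^T; apply: trmx_inj; rewrite eT trmx_mul trmxK.
  have s : ((B ^+ d.+1)^T <= (B ^+ d)^T)%MS.
    by rewrite exprSr trmx_mul submxMl.
  by rewrite -(mxrank_leqif_sup s).2 !mxrank_tr ed.
exists (T ^+ i); rewrite -(subnK le_dj) -addnA !(expmxD _ (j - d)) -mulmxA.
congr (_ *m _); elim: i => [|i IHi]; first by rewrite addn0 mulmx1.
by rewrite {1}IHi addnC expmxD eT (expmxS T) !mulmxA -expmxD addnC -addSnnS.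
Qed.

Lemma expr_mulmx_swap (F : fieldType) (m n : nat)
    (A : 'M[F]_(m, n)) (W : 'M[F]_(n, m)) (j : nat) :
  (A *m W) ^+ j *m A = A *m (W *m A) ^+ j.
Proof.
elim: j => [|j IHj]; first by rewrite !expr0 mul1mx mulmx1.
by rewrite !expmxS -mulmxA IHj !mulmxA.
Qed.

(** Both representations are instances of this one, for different [Z].  The
    hypothesis on [T] puts the range of a high power of [W A] inside the range
    of [W A W G]; the reverse inclusion holds for every [Z], because
    [W A W (A W)^l = (W A)^(l+1) W]. *)
Lemma wcepinv_mul_mpinv (C : numClosedFieldType) (m n p l : nat)
    (A : 'M[C]_(m, n)) (W : 'M[C]_(n, m)) (Z : 'M[C]_(m, p)) T :
    let G := (A *m W) ^+ l *m Z in
    (maxn (mxind (A *m W)) (mxind (W *m A)) <= l)%N ->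
    (W *m A) ^+ (l + 2) = W *m A *m W *m G *m T ->
  wcepinv A W = G *m mpinv (W *m A *m W *m G).
Proof.
move=> G hl eT; apply: wcepinv_unique (wcepinvP A W) _.
rewrite /is_wcepinv /=; set k := maxn _ _ in hl *.
apply/andP; split; last first.
  by rewrite /G -(subnKC hl) expmxD -!mulmxA trmx_mul submxMl.
rewrite [_ *m (G *m _)]mulmxA; apply/eqP.
(* [k] is at least the index of [W A], so [(W A)^k = (W A)^(l+2) U]. *)
have [U eU] := expr_stable_range (l + 2 - k) (leq_maxr _ _ : mxind (W *m A) <= k)%N.
apply: (@mpinv_proj_eq _ _ _ _ _ _
          ((W *m A) ^+ (l.+1 - k) *m W *m Z) (T *m U)).
  rewrite !(mulmxA (_ ^+ k)) -expmxD subnKC ?leqW //.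
  by rewrite expmxS -(mulmxA _ (_ ^+ l)) expr_mulmx_swap /G !mulmxA.
by rewrite mulmxA -eT {1}eU subnKC // ltnW // addn2 ltnS leqW.
Qed.

Local Open Scope complex_scope.

Theorem theorem2p10 (R : realType) (m n : nat)
    (A : 'M[R[i]]_(m, n)) (W : 'M[R[i]]_(n, m)) (l : nat)
    (hl : (maxn (mxind (A *m W)) (mxind (W *m A)) <= l)%N) :
  wcepinv A W = (A *m W) ^+ l *m mpinv (W *m (A *m W) ^+ (l + 1)) /\
  wcepinv A W = A *m (W *m A) ^+ l *m mpinv ((W *m A) ^+ (l + 2)).
Proof.
have e2 : W *m A *m W *m ((A *m W) ^+ l *m A) = (W *m A) ^+ (l + 2).
  by rewrite expr_mulmx_swap addn2 !expmxS !mulmxA.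
split.
  have e1 : W *m A *m W *m ((A *m W) ^+ l *m 1%:M) = W *m (A *m W) ^+ (l + 1).
    by rewrite mulmx1 addn1 expmxS !mulmxA.
  rewrite -e1 -[X in X *m mpinv _]mulmx1.
  by apply: (wcepinv_mul_mpinv (T := A)); rewrite // mulmx1 -e2 !mulmxA.
rewrite -e2 -expr_mulmx_swap.
by apply: (wcepinv_mul_mpinv (T := 1%:M)); rewrite // mulmx1 e2.
Qed.
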